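(* Let $(a_n)_{n\ge0}$ be the integer sequence $\mathbb{I}(3)$: $1,30,1440,85260,5606100,391231080,\dots$, i.e. the coefficient sequence of the unique power series solution $\sum_{n\ge 0} a_nt^n$ with $a_0=1$ of the operator $$10\theta^2-3t(333\theta^2+333\theta+100)+11664\,t^2\left(\theta+\tfrac56\right)\left(\theta+\tfrac76\right),\qquad \theta=t\tfrac{d}{dt}.$$ Then $(a_n)$ has a Laurent polynomial representation: for all $n\ge 0$, $a_n$ is the constant term of $F^n$, where $$F=\frac{2U^3-3U^2V-12UV^2+20V^3-3U^2+30UV-21V^2-12U-21V+20}{UV}\in\mathbb{Z}[U^{\pm1},V^{\pm1}].$$
   Context: The operator corresponds to the recursion $10(n+1)^2a_{n+1}=(999n^2+999n+300)a_n-11664\,(n-\tfrac16)(n+\tfrac16)a_{n-1}$ for $n\ge0$, with $a_{-1}=0$, $a_0=1$. The constant term of a Laurent polynomial in $U,V$ is the coefficient of $U^0V^0$. *)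

(* Defs.v *)
From HB Require Import structures.
From mathcomp Require Import all_boot all_order all_algebra.
From mathcomp Require Import finmap.
From mathcomp.multinomials Require Import monalg.

Set Implicit Arguments.
Unset Strict Implicit.
Unset Printing Implicit Defensive.

Import GRing.Theory.

Local Open Scope fset_scope.
Local Open Scope ring_scope.

(* A Laurent polynomial in U and V is a finitely supported family of
   coefficients; the exponent (i, j) : int * int stands for U^i V^j.  The
   additive structure is that of {malg R[int * int]}.  The product of [monalg]
   does not apply, because its exponent monoids have no invertible element but
   the unit; the convolution product is therefore defined here. *)
Definition laurent (R : comNzRingType) : Type := {malg R[(int * int)%type]}.

HB.instance Definition _ (R : comNzRingType) :=
  Choice.copy (laurent R) {malg R[(int * int)%type]}.

(* the coefficient of U^i V^j, where k = (i, j) *)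
Definition lcoef (R : comNzRingType) (f : laurent R) (k : int * int) : R :=
  mcoeff k f.

(* The operations are locked, so that unification does not unfold them down to
   finitely supported functions. *)
HB.lock Definition lzero (R : comNzRingType) : laurent R :=
  (0 : {malg R[(int * int)%type]}).
Arguments lzero {R}.

HB.lock Definition lopp (R : comNzRingType) (f : laurent R) : laurent R :=
  (- (f : {malg R[(int * int)%type]})).
Arguments lopp {R} f.

HB.lock Definition ladd (R : comNzRingType) (f g : laurent R) : laurent R :=
  ((f : {malg R[(int * int)%type]}) + (g : {malg R[(int * int)%type]})).
Arguments ladd {R} f g.

Section LaurentZmodule.
Variable R : comNzRingType.

Lemma laddA : associative (@ladd R).
Proof. by move=> f g h; rewrite ladd.unlock; exact: addrA. Qed.

Lemma laddC : commutative (@ladd R).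
Proof. by move=> f g; rewrite ladd.unlock; exact: addrC. Qed.

Lemma ladd0 : left_id lzero (@ladd R).
Proof. by move=> f; rewrite ladd.unlock lzero.unlock; exact: add0r. Qed.

Lemma laddN : left_inverse lzero lopp (@ladd R).
Proof.
by move=> f; rewrite ladd.unlock lopp.unlock lzero.unlock; exact: addNr.
Qed.

HB.instance Definition _ := GRing.isZmodule.Build (laurent R)
  laddA laddC ladd0 laddN.

Lemma lcoefD (f g : laurent R) k : lcoef (f + g) k = lcoef f k + lcoef g k.
Proof. by rewrite -[f + g]/(ladd f g) ladd.unlock; exact: mcoeffD. Qed.

Lemma lcoefN (f : laurent R) k : lcoef (- f) k = - lcoef f k.
Proof. by rewrite -[- f]/(lopp f) lopp.unlock; exact: mcoeffN. Qed.

Lemma lcoef0 k : lcoef (0 : laurent R) k = 0.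
Proof. by rewrite -[X in lcoef X _]/(@lzero R) lzero.unlock; exact: mcoeff0. Qed.

Lemma lcoefMn (f : laurent R) n k : lcoef (f *+ n) k = lcoef f k *+ n.
Proof.
by elim: n => [|n IHn]; rewrite ?mulr0n ?lcoef0 // !mulrS lcoefD IHn.
Qed.

Lemma laurentP (f g : laurent R) : lcoef f =1 lcoef g -> f = g.
Proof. by move=> fg; apply/malgP => k; exact: fg. Qed.

End LaurentZmodule.

HB.lock Definition lterm (R : comNzRingType) (c : R) (k : int * int) :
  laurent R := mkmalgU k c.
Arguments lterm {R} c k.

HB.lock Definition lmul (R : comNzRingType) (f g : laurent R) : laurent R :=
  \sum_(k <- msupp f) \sum_(l <- msupp g) lterm (lcoef f k * lcoef g l) (k + l).
Arguments lmul {R} f g.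

Section LaurentRing.
Variable R : comNzRingType.

Implicit Types (c : R) (f g h : laurent R) (k l : int * int).

Definition lone : laurent R := lterm 1 0.

Lemma lcoefU c k l : lcoef (lterm c k) l = c *+ (k == l).
Proof. by rewrite lterm.unlock /lcoef mcoeffU. Qed.

Lemma msupp_lterm c k : msupp (lterm c k) `<=` [fset k].
Proof. by rewrite lterm.unlock; exact: msuppU_le. Qed.

Lemma lterm0 k : lterm (0 : R) k = 0.
Proof. by apply: laurentP => l; rewrite lcoefU lcoef0 mul0rn. Qed.

Lemma ltermD c1 c2 k : lterm (c1 + c2) k = lterm c1 k + lterm c2 k.
Proof. by apply: laurentP => l; rewrite lcoefD !lcoefU mulrnDl. Qed.

Lemma lmsuppD_le f g : msupp (f + g) `<=` msupp f `|` msupp g.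
Proof. by rewrite -[f + g]/(ladd f g) ladd.unlock; exact: msuppD_le. Qed.

Lemma lcoef_sum (I : Type) (r : seq I) (F : I -> laurent R) k :
  lcoef (\sum_(i <- r) F i) k = \sum_(i <- r) lcoef (F i) k.
Proof.
by apply: (big_morph (fun f : laurent R => lcoef f k)) => [f g|];
  [exact: lcoefD | exact: lcoef0].
Qed.

Lemma lmulw (d1 d2 : {fset (int * int)}) f g :
  msupp f `<=` d1 -> msupp g `<=` d2 ->
  lmul f g = \sum_(k <- d1) \sum_(l <- d2)
               lterm (lcoef f k * lcoef g l) (k + l).
Proof.
move=> le_d1 le_d2; rewrite lmul.unlock (big_fset_incl _ le_d1) /=.
  apply/eq_bigr=> k1 _; apply/big_fset_incl => // k _ /mcoeff_outdom.
  by rewrite /lcoef => ->; rewrite mulr0 lterm0.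
move=> k _ /mcoeff_outdom fk.
by rewrite big1 => // k' _; rewrite /lcoef fk mul0r lterm0.
Qed.

Lemma lmulC : commutative (@lmul R).
Proof.
move=> f g; rewrite lmul.unlock exchange_big /=.
apply/eq_bigr => l _; apply/eq_bigr => k _.
by rewrite mulrC [k + l]addrC.
Qed.

Lemma lmul0 g : lmul 0 g = 0.
Proof.
rewrite lmul.unlock -[X in msupp X]/(@lzero R) lzero.unlock msupp0.
by rewrite big_seq_fset0.
Qed.

Lemma lmulDl : left_distributive (@lmul R) +%R.
Proof.
move=> f1 f2 g.
have sg : msupp g `<=` msupp g by [].
rewrite (@lmulw _ _ (f1 + f2) g (lmsuppD_le _ _) sg).
rewrite (@lmulw _ _ f1 g (fsubsetUl _ (msupp f2)) sg).
rewrite (@lmulw _ _ f2 g (fsubsetUr (msupp f1) _) sg) -big_split /=.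
apply/eq_bigr=> k _; rewrite -big_split /=; apply/eq_bigr=> l _.
by rewrite lcoefD mulrDl ltermD.
Qed.

Lemma lmulDr : right_distributive (@lmul R) +%R.
Proof. by move=> f g h; rewrite lmulC lmulDl !(lmulC f). Qed.

Lemma lmulUU c1 c2 k1 k2 :
  lmul (lterm c1 k1) (lterm c2 k2) = lterm (c1 * c2) (k1 + k2).
Proof.
rewrite (lmulw (msupp_lterm c1 k1) (msupp_lterm c2 k2)).
by rewrite !big_seq_fset1 !lcoefU !eqxx.
Qed.

Lemma laurentE f : f = \sum_(k <- msupp f) lterm (lcoef f k) k.
Proof.
apply: laurentP => l; rewrite lcoef_sum {1}/lcoef [in LHS](monalgE f) raddf_sum.
by apply: eq_bigr => k _; rewrite lcoefU; exact: mcoeffU.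
Qed.

Lemma lmul_sum (I : Type) (r : seq I) (F : I -> laurent R) g :
  lmul (\sum_(i <- r) F i) g = \sum_(i <- r) lmul (F i) g.
Proof.
by apply: (big_morph (lmul^~ g)) => [f1 f2|]; [exact: lmulDl|exact: lmul0].
Qed.

Lemma lmul_sumr (I : Type) (r : seq I) (F : I -> laurent R) g :
  lmul g (\sum_(i <- r) F i) = \sum_(i <- r) lmul g (F i).
Proof. by rewrite lmulC lmul_sum; apply: eq_bigr => i _; rewrite lmulC. Qed.

Lemma lmul1 : left_id lone (@lmul R).
Proof.
move=> f; rewrite [in LHS](laurentE f) lmul_sumr [RHS]laurentE.
by apply: eq_bigr => k _; rewrite lmulUU mul1r add0r.
Qed.

Lemma lmulA : associative (@lmul R).
Proof.
move=> f g h; rewrite (laurentE f) !lmul_sum; apply: eq_bigr => i _.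
rewrite (laurentE g) lmul_sumr !lmul_sum lmul_sumr; apply: eq_bigr => j _.
rewrite (laurentE h) !lmul_sumr; apply: eq_bigr => k _.
by rewrite !lmulUU mulrA addrA.
Qed.

Lemma lone_neq0 : lone != 0.
Proof.
apply/eqP => /(congr1 (fun f : laurent R => lcoef f 0)) /eqP.
by rewrite lcoefU lcoef0 eqxx oner_eq0.
Qed.

HB.instance Definition _ := GRing.Zmodule_isComNzRing.Build (laurent R)
  lmulA lmulC lmul1 lmulDl lone_neq0.

Definition constant_term f : R := lcoef f (0, 0).

Definition lmonom (i j : int) : laurent R := lterm 1 (i, j).

Lemma lmonomM i j i' j' :
  lmonom i j * lmonom i' j' = lmonom (i + i') (j + j').
Proof. by rewrite [LHS]lmulUU mul1r. Qed.

End LaurentRing.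

Definition lU : laurent int := lmonom int 1 0.
Definition lV : laurent int := lmonom int 0 1.

Lemma lUV_inv : lU * lV * lmonom int (- 1) (- 1) = 1.
Proof. by rewrite /lU /lV !lmonomM. Qed.

(* The factor lmonom int (- 1) (- 1) is 1 / (U V), by lUV_inv. *)
Definition lF : laurent int :=
  (2 * lU ^+ 3 - 3 * lU ^+ 2 * lV - 12 * lU * lV ^+ 2 + 20 * lV ^+ 3
   - 3 * lU ^+ 2 + 30 * lU * lV - 21 * lV ^+ 2 - 12 * lU - 21 * lV + 20)
  * lmonom int (- 1) (- 1).

(* A formal power series over the rationals is given by its coefficients. *)
Definition fps := nat -> rat.

(* theta = t d/dt *)
Definition theta (f : fps) : fps := fun n => n%:R * f n.

(* theta + c *)
Definition thetaD (c : rat) (f : fps) : fps := fun n => theta f n + c * f n.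

(* f |-> t f *)
Definition tmul (f : fps) : fps := fun n => if n is m.+1 then f m else 0.

(* 10 theta^2 - 3 t (333 theta^2 + 333 theta + 100)
   + 11664 t^2 (theta + 5/6) (theta + 7/6) *)
Definition opI3 (f : fps) : fps := fun n =>
  10 * theta (theta f) n
  - 3 * tmul (fun k => 333 * theta (theta f) k + 333 * theta f k + 100 * f k) n
  + 11664%:R * tmul (tmul (thetaD (5 / 6) (thetaD (7 / 6) f))) n.

(* Main.v *)
(* Constant terms kill the image of the derivations theta_U = U d/dU and
   theta_V = V d/dV.  Suppose that the vector field A theta_U + B theta_V is
   logarithmic along F, i.e. A theta_U F + B theta_V F = F Q.  Then
     F^m (theta_U A + theta_V B + m Q) = theta_U (F^m A) + theta_V (F^m B)
   has constant term 0.  There are two such fields, with coefficients supported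
   in twice the Newton polygon of F, for which, with m = n - 1,
     (theta_U A0 + theta_V B0 + m Q0) + n (theta_U A1 + theta_V B1 + m Q1)
     = 10 (n + 1)^2 F^2 - (999 n^2 + 999 n + 300) F + 11664 (n^2 - 1/36).
   Multiplying by F^m and taking constant terms gives the recursion. *)

From HB Require Import structures.
Require Import Defs.
From mathcomp Require Import all_boot all_order all_algebra.
From mathcomp Require Import finmap.
From mathcomp.multinomials Require Import monalg.
From mathcomp Require Import ring.
From Stdlib Require Import FunctionalExtensionality.

Set Implicit Arguments.
Unset Strict Implicit.

Import GRing.Theory Num.Theory.

Local Open Scope ring_scope.

(** * Derivations of the ring of Laurent polynomials *)

Lemma ltermM (R : comNzRingType) (c d : R) k l :
  lterm c k * lterm d l = lterm (c * d) (k + l).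
Proof. exact: lmulUU. Qed.

Lemma lcoefMz (R : comNzRingType) (f : laurent R) (m : int) k :
  lcoef (f *~ m) k = lcoef f k *~ m.
Proof.
case: m => n; first exact: lcoefMn.
by rewrite NegzE !mulrNz lcoefN; congr (- _); exact: lcoefMn.
Qed.

(* The derivation that multiplies U^i V^j by chi (i, j). *)
Section Derivation.

Variables (R : comNzRingType) (chi : {additive int * int -> int}).
Implicit Types f g : laurent R.

Definition lderiv f : laurent R :=
  \sum_(k <- msupp f) lterm ((chi k)%:~R * lcoef f k) k.

Lemma lcoef_lderiv f k : lcoef (lderiv f) k = (chi k)%:~R * lcoef f k.
Proof.
rewrite lcoef_sum [in RHS](laurentE f) lcoef_sum mulr_sumr.
apply: eq_bigr => l _; rewrite !lcoefU.
by case: eqP => [->|]; rewrite ?mulr0n ?mulr0.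
Qed.

Lemma lderiv_is_additive : zmod_morphism lderiv.
Proof.
move=> f g; apply: laurentP => k.
by rewrite lcoefD lcoefN !lcoef_lderiv lcoefD lcoefN mulrBr.
Qed.

HB.instance Definition _ :=
  GRing.isZmodMorphism.Build (laurent R) (laurent R) lderiv lderiv_is_additive.

Lemma lderiv_term c k : lderiv (lterm c k) = lterm ((chi k)%:~R * c) k.
Proof.
apply: laurentP => l; rewrite lcoef_lderiv !lcoefU.
by case: eqP => [->|]; rewrite ?mulr0n ?mulr0.
Qed.

(** By bilinearity it is enough to treat two monomials, where the Leibniz rule is the additivity of
    [chi] on exponents. *)
Lemma lderivM f g : lderiv (f * g) = lderiv f * g + f * lderiv g.
Proof.
rewrite (laurentE f) mulr_suml !raddf_sum !mulr_suml -big_split.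
apply: eq_bigr => k _ /=.
rewrite (laurentE g) mulr_sumr !raddf_sum !mulr_sumr -big_split.
apply: eq_bigr => l _ /=.
rewrite ltermM !lderiv_term !ltermM -ltermD (raddfD chi) intrD.
by congr lterm; ring.
Qed.

Lemma lderiv1 : lderiv 1 = 0.
Proof. by rewrite lderiv_term raddf0 mul0r lterm0. Qed.

Lemma lderiv_nat n : lderiv n%:R = 0.
Proof. by rewrite raddfMn /= lderiv1 mul0rn. Qed.

Lemma lderivD f g : lderiv (f + g) = lderiv f + lderiv g.
Proof. exact: raddfD. Qed.

Lemma lderivN f : lderiv (- f) = - lderiv f.
Proof. exact: raddfN. Qed.

Lemma lderivX f n : lderiv (f ^+ n.+1) = n.+1%:R * f ^+ n * lderiv f.
Proof.
elim: n => [|n IHn]; first by ring.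
by rewrite exprS lderivM IHn exprS; ring.
Qed.

(** In these variants of the rules the derivatives of the parts are premises, so a derivative that
    is still an existential variable gets filled in while a term is traversed. *)
Lemma lderivD_eq f g f' g' :
  lderiv f = f' -> lderiv g = g' -> lderiv (f + g) = f' + g'.
Proof. by rewrite lderivD => -> ->. Qed.

Lemma lderivN_eq f f' : lderiv f = f' -> lderiv (- f) = - f'.
Proof. by rewrite lderivN => ->. Qed.

Lemma lderivM_eq f g f' g' :
  lderiv f = f' -> lderiv g = g' -> lderiv (f * g) = f' * g + f * g'.
Proof. by rewrite lderivM => -> ->. Qed.

Lemma lderivX_eq f f' n :
  lderiv f = f' -> lderiv (f ^+ n.+1) = n.+1%:R * f ^+ n * f'.
Proof. by rewrite lderivX => ->. Qed.

Lemma constant_term_lderiv f : constant_term (lderiv f) = 0.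
Proof. by rewrite /constant_term lcoef_lderiv (raddf0 chi) mul0r. Qed.

End Derivation.

(** * The two logarithmic vector fields along F *)

(* W stands for 1 / (U V).  The coefficients were found by linear algebra over
   the rationals. *)
Section Certificate.

Variables (R : comNzRingType) (U V W : R).

Definition certificate_A0 : R :=
  ((- 8000%:R + 12600%:R * V + 3990 * V ^+ 2 - 8410%:R * V ^+ 3
       - 4200 * V ^+ 5 + 4000 * V ^+ 6)
   + U * (4800 - 6100%:R * V + 81 * V ^+ 2 + 16224%:R * V ^+ 3 - 805 * V ^+ 4
       - 13500%:R * V ^+ 5)
   + U ^+ 2 * (1200 - 5082%:R * V + 6498%:R * V ^+ 2 - 10272%:R * V ^+ 3
       + 5460%:R * V ^+ 4)
   + U ^+ 3 * (- 1200 - 63 * V + 942 * V ^+ 2 + 2025 * V ^+ 3)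
   + U ^+ 4 * (240 + 332 * V - 780 * V ^+ 2)
   + U ^+ 5 * 60
   + U ^+ 6 * (- 40))
  * W ^+ 2.

Definition certificate_B0 : R :=
  ((4000 - 8400%:R * V - 3990 * V ^+ 2 + 16820%:R * V ^+ 3 - 3990 * V ^+ 4
       - 8400%:R * V ^+ 5 + 4000 * V ^+ 6)
   + U * (- 2960 * V - 1692 * V ^+ 2 + 8148%:R * V ^+ 3 + 2080 * V ^+ 4
       - 4800 * V ^+ 5)
   + U ^+ 2 * (- 1440 + 2952 * V - 2952 * V ^+ 3 + 1440 * V ^+ 4)
   + U ^+ 3 * (- 1520 + 72 * V ^+ 2 - 800 * V ^+ 3)
   + U ^+ 4 * (870 - 188 * V + 390 * V ^+ 2)
   + U ^+ 5 * (240 + 240 * V)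
   + U ^+ 6 * (- 120))
  * W ^+ 2.

Definition certificate_Q0 : R :=
  ((4000 - 8400%:R * V - 3990 * V ^+ 2 + 16820%:R * V ^+ 3 - 3990 * V ^+ 4
       - 8400%:R * V ^+ 5 + 4000 * V ^+ 6)
   + U * (- 1980 * V + 5979%:R * V ^+ 2 - 2016 * V ^+ 3 - 6075%:R * V ^+ 4
       + 3900 * V ^+ 5)
   + U ^+ 2 * (2640 + 588 * V - 5076%:R * V ^+ 2 + 588 * V ^+ 3
       + 2640 * V ^+ 4)
   + U ^+ 3 * (320 + 957 * V + 1962 * V ^+ 2 - 295 * V ^+ 3)
   + U ^+ 4 * (- 870 + 72 * V - 1170 * V ^+ 2)
   + U ^+ 5 * (- 180 - 120 * V)
   + U ^+ 6 * (40))
  * W ^+ 2.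

Definition certificate_A1 : R :=
  ((- 4000 + 8400%:R * V + 3990 * V ^+ 2 - 16820%:R * V ^+ 3 + 3990 * V ^+ 4
       + 8400%:R * V ^+ 5 - 4000 * V ^+ 6)
   + U * (2960 * V + 1101 * V ^+ 2 + 20928%:R * V ^+ 3 - 11005%:R * V ^+ 4
       - 15000%:R * V ^+ 5)
   + U ^+ 2 * (1440 - 6660%:R * V - 4392 * V ^+ 2 + 5556%:R * V ^+ 3
       + 2820 * V ^+ 4)
   + U ^+ 3 * (320 - 1728 * V ^+ 2 + 3080 * V ^+ 3)
   + U ^+ 4 * (- 150 + 890 * V)
   + U ^+ 5 * (- 60 - 60 * V))
  * W ^+ 2.

Definition certificate_B1 : R :=
  (U * (7200%:R - 16100%:R * V - 9693%:R * V ^+ 2 + 27822%:R * V ^+ 3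
       + 3115 * V ^+ 4 - 11100%:R * V ^+ 5)
   + U ^+ 2 * (960 - 1968 * V + 1968 * V ^+ 3 - 960 * V ^+ 4)
   + U ^+ 3 * (- 1960 + 723 * V - 4290 * V ^+ 2 + 1775 * V ^+ 3)
   + U ^+ 4 * (1708 * V + 780 * V ^+ 2)
   + U ^+ 5 * (60 * V)
   + U ^+ 6 * (- 40))
  * W ^+ 2.

Definition certificate_Q1 : R :=
  ((4000 - 8400%:R * V - 3990 * V ^+ 2 + 16820%:R * V ^+ 3 - 3990 * V ^+ 4
       - 8400%:R * V ^+ 5 + 4000 * V ^+ 6)
   + U * (- 4800 - 2940 * V + 8619%:R * V ^+ 2 + 8619%:R * V ^+ 3
       - 2940 * V ^+ 4 - 4800 * V ^+ 5)
   + U ^+ 2 * (240 + 4848 * V - 3906 * V ^+ 2 + 4848 * V ^+ 3 + 240 * V ^+ 4)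
   + U ^+ 3 * (1520 + 1077 * V + 1077 * V ^+ 2 + 1520 * V ^+ 3)
   + U ^+ 4 * (- 390 - 618 * V - 390 * V ^+ 2)
   + U ^+ 5 * (- 120 - 120 * V)
   + U ^+ 6 * (40))
  * W ^+ 2.

End Certificate.

Local Notation lW := (lmonom int (- 1) (- 1)).
Local Notation theta_U := (@lderiv int fst).
Local Notation theta_V := (@lderiv int snd).

Lemma lderiv_monom (chi : {additive int * int -> int}) i j :
  lderiv chi (lmonom int i j) = (chi (i, j))%:~R * lmonom int i j.
Proof.
apply: laurentP => k; rewrite lcoef_lderiv !mulrzl lcoefMz !lcoefU.
by case: eqP => [->|]; rewrite ?mulr0n ?mul0rz.
Qed.

Lemma theta_UE : (theta_U lU = lU) * (theta_U lV = 0) * (theta_U lW = - lW).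
Proof. by rewrite !lderiv_monom /= mulr1z mul0r mulN1r mul1r. Qed.

Lemma theta_VE : (theta_V lU = 0) * (theta_V lV = lV) * (theta_V lW = - lW).
Proof. by rewrite !lderiv_monom /= mulr1z mul0r mulN1r mul1r. Qed.

(* Rewriting with lderivD would match a numeral n%:R by unfolding it to a sum,
   so the derivative is built by recursion on the syntax instead. *)
Ltac lderiv_compute :=
  lazymatch goal with
  | |- lderiv _ (_ + _) = _ => apply lderivD_eq; lderiv_compute
  | |- lderiv _ (- _) = _ => apply lderivN_eq; lderiv_compute
  | |- lderiv _ (_ * _) = _ => apply lderivM_eq; lderiv_compute
  | |- lderiv _ (_ ^+ _) = _ => apply lderivX_eq; lderiv_compute
  | |- lderiv _ (_ %:R) = _ => apply lderiv_nat
  | |- lderiv _ _ = _ => rewrite ?theta_UE ?theta_VE; reflexivity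
  end.

Tactic Notation "differentiate" constr(theta) constr(f) reference(F) :=
  let E := fresh in
  eassert (E : theta f = _);
    [unfold F; lderiv_compute | rewrite {}E].

Lemma logarithmic_field0 :
  certificate_A0 lU lV lW * theta_U lF + certificate_B0 lU lV lW * theta_V lF
  = lF * certificate_Q0 lU lV lW.
Proof.
differentiate theta_U lF lF; differentiate theta_V lF lF; rewrite /lF.
rewrite /certificate_A0 /certificate_B0 /certificate_Q0.
(* Both sides are [W ^+ 3] times a polynomial in U and V, so the identity already holds for
   independent U, V, W; the relation U V W = 1 enters only through the derivatives of W. *)
by move: lU lV lW => U V W; ring.
Qed.

Lemma logarithmic_field1 :
  certificate_A1 lU lV lW * theta_U lF + certificate_B1 lU lV lW * theta_V lF
  = lF * certificate_Q1 lU lV lW.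
Proof.
differentiate theta_U lF lF; differentiate theta_V lF lF; rewrite /lF.
rewrite /certificate_A1 /certificate_B1 /certificate_Q1.
by move: lU lV lW => U V W; ring.
Qed.

(** * From the vector fields to the recursion for the constant terms *)

Definition twisted_div (A B Q : laurent int) m :=
  theta_U A + theta_V B + m%:R * Q.

Lemma constant_term_twisted_div (f A B Q : laurent int) m :
  A * theta_U f + B * theta_V f = f * Q ->
  constant_term (f ^+ m * twisted_div A B Q m) = 0.
Proof.
move=> AB; suff -> : f ^+ m * twisted_div A B Q m =
    theta_U (f ^+ m * A) + theta_V (f ^+ m * B).
  by rewrite /constant_term lcoefD -!/(constant_term _) !constant_term_lderiv.
rewrite !lderivM /twisted_div; case: m => [|m].
  by rewrite !expr0 -[1]/(1%:R) !lderiv_nat; ring.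
rewrite !lderivX.
(* One factor f is split off to expose [f * Q], which the hypothesis turns into the derivatives of
   f. *)
transitivity (f ^+ m.+1 * (theta_U A + theta_V B)
  + m.+1%:R * (f ^+ m * (f * Q))).
  by rewrite exprS; ring.
by rewrite -AB exprS; ring.
Qed.

(** This is the combination of the two fields that gives the recursion, with n = m + 1; the constant
    324 is 11664/36. *)
Lemma telescoping m :
  twisted_div (certificate_A0 lU lV lW) (certificate_B0 lU lV lW)
    (certificate_Q0 lU lV lW) m
  + m.+1%:R * twisted_div (certificate_A1 lU lV lW) (certificate_B1 lU lV lW)
    (certificate_Q1 lU lV lW) m
  = 10 * m.+2%:R ^+ 2 * lF ^+ 2
    - (999 * m.+1%:R ^+ 2 + 999 * m.+1%:R + 300) * lF
    + (11664%:R * m.+1%:R ^+ 2 - 324).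
Proof.
have UVW : lU * lV * lW = 1 by exact: lUV_inv.
(* Powers of U V W = 1 are inserted to make every term of degree 2 in W. The identity then holds for
   independent U, V, W and [ring] can decide it. *)
rewrite /twisted_div; transitivity (10 * m.+2%:R ^+ 2 * lF ^+ 2
    - (999 * m.+1%:R ^+ 2 + 999 * m.+1%:R + 300) * (lF * (lU * lV * lW))
    + (11664%:R * m.+1%:R ^+ 2 - 324) * (lU * lV * lW) ^+ 2); last first.
  by rewrite UVW expr1n !mulr1.
differentiate theta_U (certificate_A0 lU lV lW) certificate_A0.
differentiate theta_V (certificate_B0 lU lV lW) certificate_B0.
differentiate theta_U (certificate_A1 lU lV lW) certificate_A1.
differentiate theta_V (certificate_B1 lU lV lW) certificate_B1.
rewrite /certificate_A0 /certificate_B0 /certificate_Q0.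
rewrite /certificate_A1 /certificate_B1 /certificate_Q1.
rewrite /lF; move: lU lV lW {UVW} => U V W.
by ring.
Qed.

Definition ct_lF n : int := constant_term (lF ^+ n).

Lemma constant_termMz (k : int) (f : laurent int) :
  constant_term (k%:~R * f) = k * constant_term f.
Proof. by rewrite mulrzl /constant_term lcoefMz -mulrzl intz. Qed.

Lemma ct_lF_rec n :
  10 * n.+2%:R ^+ 2 * ct_lF n.+2
  - (999 * n.+1%:R ^+ 2 + 999 * n.+1%:R + 300) * ct_lF n.+1
  + (11664%:R * n.+1%:R ^+ 2 - 324) * ct_lF n = 0.
Proof.
have ctD f g : constant_term (f + g) = constant_term f + constant_term g :> int.
  exact: lcoefD.
have ctN f : constant_term (- f) = - constant_term f :> int by exact: lcoefN.
have H0 := constant_term_twisted_div n logarithmic_field0.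
have H1 := constant_term_twisted_div n logarithmic_field1.
have : constant_term (lF ^+ n * (10 * n.+2%:R ^+ 2 * lF ^+ 2
    - (999 * n.+1%:R ^+ 2 + 999 * n.+1%:R + 300) * lF
    + (11664%:R * n.+1%:R ^+ 2 - 324))) = 0.
  rewrite -telescoping; move: H0 H1.
  set D0 := twisted_div _ _ _ _; set D1 := twisted_div _ _ _ _ => H0 H1.
  have -> : lF ^+ n * (D0 + n.+1%:R * D1) =
      lF ^+ n * D0 + n.+1%:~R * (lF ^+ n * D1) by ring.
  by rewrite ctD constant_termMz H0 H1 mulr0.
(* The coefficients become images of integers, so that [constant_termMz] can take them out of the
   constant term. *)
have -> : lF ^+ n * (10 * n.+2%:R ^+ 2 * lF ^+ 2
    - (999 * n.+1%:R ^+ 2 + 999 * n.+1%:R + 300) * lF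
    + (11664%:R * n.+1%:R ^+ 2 - 324)) =
    (10 * n.+2%:R ^+ 2)%:~R * lF ^+ n.+2
    - (999 * n.+1%:R ^+ 2 + 999 * n.+1%:R + 300)%:~R * lF ^+ n.+1
    + (11664%:R * n.+1%:R ^+ 2 - 324)%:~R * lF ^+ n.
  by rewrite !exprS; move: lF (lF ^+ n) => F G; ring.
by rewrite !ctD ctN !constant_termMz.
Qed.

(** * Initial values *)

Lemma lmonom_nat (i j : nat) :
  lU ^+ i * lV ^+ j * lW = lmonom int (i%:Z - 1) (j%:Z - 1).
Proof.
suff -> : lU ^+ i * lV ^+ j = lmonom int i j by rewrite lmonomM.
elim: i => [|i IHi]; last by rewrite exprS -mulrA IHi lmonomM add0r -intS.
elim: j => [|j IHj]; first by rewrite mulr1.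
by rewrite exprS mulrCA IHj lmonomM add0r -intS.
Qed.

Lemma ct_lF0 : ct_lF 0 = 1.
Proof. by rewrite /ct_lF expr0 /constant_term lcoefU eqxx. Qed.

Lemma ct_lF1 : ct_lF 1 = 30.
Proof.
(* [T i j] is the monomial with exponents i - 1 and j - 1, so only [T 1 1] contributes to the
   constant term, with coefficient 30. *)
pose T i j := lU ^+ i * lV ^+ j * lW.
have -> : ct_lF 1 = constant_term (2 * T 3%N 0%N - 3 * T 2%N 1%N
  - 12 * T 1%N 2%N + 20 * T 0%N 3%N - 3 * T 2%N 0%N + 30 * T 1%N 1%N
  - 21 * T 0%N 2%N - 12 * T 1%N 0%N - 21 * T 0%N 1%N + 20 * T 0%N 0%N).
  by congr constant_term; rewrite /lF /T; ring.
rewrite /T !lmonom_nat /constant_term.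
by rewrite !(lcoefD, lcoefN) !mulr_natl !lcoefMn !lcoefU.
Qed.

(** * The differential operator and its unique normalised solution *)

(** The factor t^2 shifts the index by two: at the exponent n - 1 the last factor of the operator is
    (n - 1/6)(n + 1/6) = n^2 - 1/36. The term [tmul a n] stands for a_{n-1}, with a_{-1} = 0. *)
Lemma opI3S (a : fps) n : opI3 a n.+1 =
  10 * n.+1%:R ^+ 2 * a n.+1
  - (999 * n%:R ^+ 2 + 999 * n%:R + 300) * a n
  + (11664%:R * n%:R ^+ 2 - 324) * tmul a n.
Proof. by case: n => [|n]; rewrite /opI3 /tmul /thetaD /theta; field. Qed.

Lemma opI3_ct_lF n : opI3 (fun n => (ct_lF n)%:~R) n = 0.
Proof.
(* The recursion [ct_lF_rec] only covers coefficients from index 2 on. Coefficient 0 vanishes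
   because theta kills constants, and coefficient 1 is 10 a_1 - 300 a_0, which needs the initial
   values 1 and 30. *)
case: n => [|[|n]]; first by rewrite /opI3 /theta /tmul; ring.
  by rewrite opI3S /tmul ct_lF1 ct_lF0; ring.
have E := congr1 (fun k : int => k%:~R : rat) (ct_lF_rec n).
rewrite opI3S /tmul -[RHS]/(0%:~R : rat) -[RHS]E.
by move: (ct_lF _) (ct_lF _) (ct_lF _) {E} => x y z; ring.
Qed.

Lemma opI3_inj (a b : fps) : a 0%N = b 0%N ->
  (forall n, opI3 a n = 0) -> (forall n, opI3 b n = 0) -> a = b.
Proof.
move=> ab0 a_sol b_sol; apply: functional_extensionality => n.
(* The recursion has order two, so the induction carries two consecutive coefficients; the nonzero
   leading factor 10 (n + 1)^2 then determines the next one. *)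
suff: a n = b n /\ tmul a n = tmul b n by case.
elim: n => [|n [IHn IHn']]; first by [].
split=> //; have c0 : 10 * n.+1%:R ^+ 2 != 0 :> rat.
  by rewrite mulf_neq0 // expf_neq0 // pnatr_eq0.
apply: (mulfI c0).
have := a_sol n.+1; rewrite opI3S IHn IHn' -(b_sol n.+1) opI3S.
by move=> /addIr /addIr.
Qed.

Theorem mainTheorem7 :
  (exists! a : fps, a 0%N = 1 /\ (forall n : nat, opI3 a n = 0)) /\
  (forall a : fps, a 0%N = 1 -> (forall n : nat, opI3 a n = 0) ->
     forall n : nat, a n = (constant_term (lF ^+ n))%:~R).
Proof.
have ct0 : (ct_lF 0)%:~R = 1 :> rat by rewrite ct_lF0.
have uniq a : a 0%N = 1 -> (forall n, opI3 a n = 0) ->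
    a = fun n => (ct_lF n)%:~R.
  move=> a0 a_sol.
  exact: (opI3_inj (etrans a0 (esym ct0)) a_sol opI3_ct_lF).
split; last by move=> a a0 a_sol n; rewrite (uniq a a0 a_sol).
exists (fun n => (ct_lF n)%:~R); split.
  by split; [exact: ct0 | exact: opI3_ct_lF].
by move=> a [a0 a_sol]; rewrite (uniq a a0 a_sol).
Qed.
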